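(* Let $m,r\ge1$ be integers, let $g(t)=\sum_{n\ge0}g_n\frac{t^n}{n!}$ be a formal power series with $g_0\ne0$, put $A(t)=1/g(t)$, let ${}_{{}_LH^{(m,r)}}A_n(x,y,z)$ $(n\ge0)$ be the associated Laguerre-Gould Hopper based Appell polynomials, and let ${}_{H^{(r)}}A_n(y,z)$ be the associated Gould Hopper based Appell polynomials. Then for every $n\ge0$ $${}_{{}_LH^{(m,r)}}A_n(x,y,z)=\exp\left(D_x^{-1}\frac{\partial^m}{\partial y^m}\right){}_{H^{(r)}}A_n(y,z).$$
   Context: Coefficients are real (or complex) numbers. The Laguerre-Gould Hopper based Appell polynomials are defined by the formal generating function $$A(t)\,C_0(-xt^m)\exp(yt+zt^r)=\sum_{n=0}^{\infty}{}_{{}_LH^{(m,r)}}A_n(x,y,z)\frac{t^n}{n!},\qquad A(t)=\frac{1}{g(t)},$$ where $C_0(x)=\sum_{k\ge0}\frac{(-1)^kx^k}{(k!)^2}$ is the Bessel-Tricomi function of order zero. The Gould Hopper based Appell polynomials are the special case $x=0$: ${}_{H^{(r)}}A_n(y,z):={}_{{}_LH^{(m,r)}}A_n(0,y,z)$, i.e. $A(t)\exp(yt+zt^r)=\sum_{n\ge0}{}_{H^{(r)}}A_n(y,z)\frac{t^n}{n!}$. $D_x^{-1}$ is the inverse derivative operator acting on polynomials in $x$ (linearly over the other variables) by $D_x^{-1}\{x^k\}=\frac{x^{k+1}}{k+1}$; in particular $D_x^{-k}\{1\}=\frac{x^k}{k!}$, and ${}_{H^{(r)}}A_n(y,z)$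 is regarded as constant in $x$. The exponential of an operator is given by its power series, which is a finite sum when applied to a polynomial in $y$. *)

(* Defs.v *)
From HB Require Import structures.
From mathcomp Require Import all_boot all_order all_algebra.
From mathcomp Require Import boolp classical_sets functions cardinality fsbigop.
From mathcomp Require Import mpoly.

Set Implicit Arguments.
Unset Strict Implicit.
Unset Printing Implicit Defensive.

Import GRing.Theory Num.Theory.
Local Open Scope ring_scope.

(* A formal power series in t over S is its sequence of coefficients
   f : nat -> S, with f n the coefficient of t^n. *)
Section FormalPowerSeries.

Definition fps_one (S : nzRingType) : nat -> S := fun n => (n == 0%N)%:R.

(* c * t^d *)
Definition fps_monomial (S : nzRingType) (c : S) (d : nat) : nat -> S :=
  fun n => if n == d then c else 0.

Definition fps_add (S : nzRingType) (f h : nat -> S) : nat -> S :=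
  fun n => f n + h n.

Definition fps_mul (S : nzRingType) (f h : nat -> S) : nat -> S :=
  fun n => \sum_(i < n.+1) f i * h (n - i)%N.

Definition fps_exp (S : nzRingType) (f : nat -> S) (k : nat) : nat -> S :=
  iter k (fps_mul f) (@fps_one S).

(* The composite \sum_k c_k f(t)^k, for f without constant term: t^k then
   divides f(t)^k, so only the k <= n contribute to the coefficient of t^n. *)
Definition fps_comp (K : nzRingType) (S : lalgType K)
    (c : nat -> K) (f : nat -> S) : nat -> S :=
  fun n => \sum_(k < n.+1) c k *: fps_exp f k n.

(* \sum_n g_n t^n / n! *)
Definition egf (K : fieldType) (g : nat -> K) : nat -> K :=
  fun n => g n / n`!%:R.

(* Coefficients 0, ..., n of 1 / f(t), from
   b_0 = 1 / f_0  and  f_0 b_n = - \sum_(1 <= i <= n) f_i b_(n - i). *)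
Fixpoint fps_inv_seq (K : fieldType) (f : nat -> K) (n : nat) : seq K :=
  if n is n'.+1 then
    let s := fps_inv_seq f n' in
    rcons s (- (f 0%N)^-1 * \sum_(i < n) f i.+1 * s`_(n' - i))
  else [:: (f 0%N)^-1].

Definition fps_inv (K : fieldType) (f : nat -> K) : nat -> K :=
  fun n => (fps_inv_seq f n)`_n.

Lemma size_fps_inv_seq (K : fieldType) (f : nat -> K) n :
  size (fps_inv_seq f n) = n.+1.
Proof. by elim: n => //= n IHn; rewrite size_rcons IHn. Qed.

Lemma nth_fps_inv_seq (K : fieldType) (f : nat -> K) n i :
  (i <= n)%N -> (fps_inv_seq f n)`_i = fps_inv f i.
Proof.
elim: n => [|n IHn]; first by rewrite leqn0 => /eqP ->.
rewrite leq_eqVlt => /predU1P[-> //|lt_in].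
by rewrite /= nth_rcons size_fps_inv_seq lt_in IHn.
Qed.

Lemma fps_mulV (K : fieldType) (f : nat -> K) :
  f 0%N != 0 -> fps_mul f (fps_inv f) = @fps_one K.
Proof.
move=> f0; apply: funext => -[|n]; rewrite /fps_mul /fps_one.
  by rewrite big_ord1 divff.
rewrite big_ord_recl subn0 {1}/fps_inv /= nth_rcons size_fps_inv_seq ltnn eqxx.
rewrite mulrA mulrN divff // mulN1r.
apply/eqP; rewrite addrC subr_eq0; apply/eqP; apply: eq_bigr => i _.
by rewrite /bump /= add1n subSS nth_fps_inv_seq ?leq_subr.
Qed.

End FormalPowerSeries.

Section Operators.

(* The antiderivative with respect to the i-th variable: the linear operator
   with X^m |-> X_i X^m / (m_i + 1). *)
Definition mantideriv (K : fieldType) (d : nat) (i : 'I_d)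
    (p : {mpoly K[d]}) : {mpoly K[d]} :=
  \sum_(m <- msupp p) (p@_m / (m i).+1%:R) *: 'X_[(m + U_(i))%MM].

Lemma mantiderivX (K : fieldType) (d : nat) (i : 'I_d) (m : 'X_{1..d}) :
  mantideriv i ('X_[m] : {mpoly K[d]}) = (m i).+1%:R^-1 *: 'X_[(m + U_(i))%MM].
Proof. by rewrite /mantideriv msuppX big_seq1 mcoeffX eqxx mul1r. Qed.

(* exp(T) p = \sum_k T^k p / k!, a sum over all k of which only finitely many
   terms are nonzero when T is locally nilpotent. *)
Definition exp_op (K : fieldType) (V : lmodType K) (T : V -> V) (p : V) : V :=
  \sum_(k \in [set: nat]) (k`!%:R^-1 *: iter k T p).

Lemma exp_op_finite (K : fieldType) (V : lmodType K) (T : V -> V) (p : V) N :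
  (forall k, (N <= k)%N -> iter k T p = 0) ->
  exp_op T p = \sum_(k < N) k`!%:R^-1 *: iter k T p.
Proof.
move=> TN; rewrite /exp_op (fsbigE _ _ (iota_uniq 0 N)) //.
  rewrite -(big_mkord xpredT (fun k => k`!%:R^-1 *: iter k T p)).
  by rewrite /index_iota subn0; apply: eq_bigl => k; rewrite in_setT.
by move=> k _; rewrite mem_iota add0n -leqNgt => /TN ->; rewrite scaler0.
Qed.

End Operators.

Section LaguerreGouldHopperAppell.
Variables (K : numFieldType) (m r : nat) (g : nat -> K).

Definition ix : 'I_3 := inord 0.
Definition iy : 'I_3 := inord 1.
Definition iz : 'I_3 := inord 2.

Local Notation P := {mpoly K[3]}.

Definition bessel_tricomi0 : nat -> K := fun k => (-1) ^+ k / k`!%:R ^+ 2.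

Definition exp_series : nat -> K := fun k => k`!%:R^-1.

(* A(t) = 1 / g(t) with constant coefficients in K[x, y, z] *)
Definition appell_series : nat -> P := fun n => (fps_inv (egf g) n)%:MP.

(* A(t) C_0(- x t^m) exp(y t + z t^r) *)
Definition LGHA_series : nat -> P :=
  fps_mul (fps_mul appell_series
                   (fps_comp bessel_tricomi0 (fps_monomial (- 'X_ix : P) m)))
          (fps_comp exp_series
             (fps_add (fps_monomial ('X_iy : P) 1) (fps_monomial ('X_iz : P) r))).

Definition LGHA (n : nat) : P := n`!%:R *: LGHA_series n.

Definition GHA (n : nat) : P :=
  LGHA n \mPo [tuple if i == ix then 0 else 'X_i | i < 3].

(* D_x^-1 d^m/dy^m *)
Definition Dxinv_Dym (p : P) : P := mantideriv ix (iter m (mderiv iy) p).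

End LaguerreGouldHopperAppell.

(* Main.v *)
(* With E = exp(y t + z t^r) one has dE/dy = t E, so d/dy lowers the index of
   the coefficients H_n of A(t) E by one.  The coefficients of C_0(- x t^m)
   are x^k / (k!)^2 at t^(m k), and (D_x^-1)^k 1 = x^k / k!, so both sides equal
   n! \sum_k x^k / (k!)^2 H_(n - m k). *)
From HB Require Import structures.
Require Import Defs.
From mathcomp Require Import all_boot all_order all_algebra.
From mathcomp Require Import ssrcomplements mpoly.

Set Implicit Arguments.
Unset Strict Implicit.
Unset Printing Implicit Defensive.

Import GRing.Theory Num.Theory.
Local Open Scope ring_scope.

(** * Formal power series through truncation to polynomials *)

Section FormalPowerSeries.
Variable R : comNzRingType.
Implicit Types (f g h : nat -> R) (p q : {poly R}).

Lemma eq_fps_mul f f' h h' n :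
  (forall i, (i <= n)%N -> f i = f' i) -> (forall i, (i <= n)%N -> h i = h' i) ->
  fps_mul f h n = fps_mul f' h' n.
Proof.
move=> eq_f eq_h; apply: eq_bigr => i _.
by rewrite eq_f ?eq_h ?leq_subr // -ltnS.
Qed.

Lemma fps_mul_coef p q n : fps_mul (fun i => p`_i) (fun i => q`_i) n = (p * q)`_n.
Proof. by rewrite coefM. Qed.

(** The coefficient at [n] only sees terms of degree at most [n], so truncation turns identities of
    [{poly R}] into identities of series. *)
Lemma fps_mulE N f h n : (n <= N)%N ->
  fps_mul f h n = ((\poly_(i < N.+1) f i) * (\poly_(i < N.+1) h i))`_n.
Proof.
move=> le_nN; rewrite -fps_mul_coef; apply: eq_fps_mul => i le_in;
  by rewrite coef_poly ltnS (leq_trans le_in le_nN).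
Qed.

Lemma fps_mulCA f g h n :
  fps_mul (fps_mul f g) h n = fps_mul g (fps_mul f h) n.
Proof.
pose tr u : {poly R} := \poly_(i < n.+1) u i.
have tr_coef u i : (i <= n)%N -> u i = (tr u)`_i by rewrite coef_poly ltnS => ->.
transitivity ((tr f * tr g * tr h)`_n).
  rewrite -fps_mul_coef; apply: eq_fps_mul => i le_in; last exact: tr_coef.
  exact: fps_mulE.
rewrite mulrAC mulrC -fps_mul_coef; apply: eq_fps_mul => i le_in.
  by rewrite -tr_coef.
by rewrite (@fps_mulE n).
Qed.

Lemma fps_exp_coef f p k n : (forall i, f i = p`_i) -> fps_exp f k n = (p ^+ k)`_n.
Proof.
move=> fE; elim: k n => [|k IHk] n; first by rewrite coef1.
rewrite exprS -fps_mul_coef /fps_exp iterS; apply: eq_fps_mul => i _ //.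
exact: IHk.
Qed.

Lemma fps_exp_monomial (c : R) d k n :
  fps_exp (fps_monomial c d) k n = c ^+ k *+ (n == d * k)%N.
Proof.
rewrite (@fps_exp_coef _ (c *: 'X^d)) => [|i].
  by rewrite exprZn -exprM coefZ coefXn mulr_natr.
by rewrite coefZ coefXn /fps_monomial mulr_natr; case: eqP.
Qed.

End FormalPowerSeries.

(** The composite is supported on the exponents [d * k], so each [k] selects at most one term of the
    convolution. *)
Lemma fps_mul_comp_monomial (K : fieldType) (S : comAlgType K)
    (c : nat -> K) (a : S) (d : nat) (h : nat -> S) (n : nat) : (0 < d)%N ->
  fps_mul (fps_comp c (fps_monomial a d)) h n =
  \sum_(k < n.+1) c k *: (a ^+ k * (if (d * k <= n)%N then h (n - d * k)%N else 0)).
Proof.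
move=> d_gt0.
have compE i : (i <= n)%N -> fps_comp c (fps_monomial a d) i =
    \sum_(k < n.+1) c k *: (a ^+ k *+ (i == d * k)%N).
  move=> le_in; rewrite /fps_comp.
  under eq_bigr do rewrite fps_exp_monomial.
  (* The range [k <= i] is enlarged to [k <= n], independent of [i], so that the two sums can be
     exchanged; the added terms vanish because [d * k >= k > i]. *)
  rewrite (big_ord_widen n.+1 (fun k => c k *: (a ^+ k *+ (i == d * k)%N))) //.
  rewrite big_mkcond; apply: eq_bigr => k _.
  case: ltnP => // lt_ik; rewrite [i == _]ltn_eqF ?scaler0 //.
  by rewrite (leq_trans lt_ik) // leq_pmull.
rewrite /fps_mul.
under eq_bigr => i _ do rewrite compE -1?ltnS // mulr_suml.
rewrite exchange_big; apply: eq_bigr => k _ /=.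
under eq_bigr do rewrite -scalerAl mulrnAl.
rewrite -scaler_sumr; congr (_ *: _).
case: leqP => [le_dk_n|lt_n_dk].
  rewrite (bigD1 (Ordinal (le_dk_n : (d * k < n.+1)%N))) //= eqxx big1 ?addr0 //.
  by move=> i; rewrite -val_eqE /= => /negPf->.
rewrite mulr0 big1 // => i _.
by rewrite ltn_eqF ?(leq_trans (ltn_ord i)).
Qed.

(** * Linearity of the antiderivative *)

Section Antiderivative.
Variables (K : fieldType) (d : nat) (i : 'I_d).
Implicit Types p q : {mpoly K[d]}.

(** Replaces the support of [p] by an index set that several polynomials can share, so that
    linearity can be checked termwise. *)
Lemma mantideriv_widen N p : (msize p <= N)%N ->
  mantideriv i p =
  \sum_(u : 'X_{1..d < N}) (p@_u / (u i).+1%:R) *: 'X_[(u + U_(i))%MM].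
Proof.
move=> leN; pose I : subFinType _ := 'X_{1..d < N}.
rewrite /mantideriv (big_mksub I) /=; first last.
- by move=> u /msize_mdeg_lt/leq_trans/(_ leN).
- by rewrite msupp_uniq.
rewrite big_rmcond //= => u /memN_msupp_eq0 ->.
by rewrite mul0r scale0r.
Qed.

Lemma mantideriv_is_linear : linear (@mantideriv K d i).
Proof.
move=> c p q.
pose N := maxn (msize (c *: p + q)) (maxn (msize p) (msize q)).
rewrite !(@mantideriv_widen N) ?leq_max ?leqnn ?orbT //.
rewrite scaler_sumr -big_split; apply: eq_bigr => u _ /=.
by rewrite mcoeffD mcoeffZ mulrDl scalerDl -mulrA scalerA.
Qed.

HB.instance Definition _ :=
  GRing.isLinear.Build K {mpoly K[d]} {mpoly K[d]} _ (@mantideriv K d i)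
    mantideriv_is_linear.

End Antiderivative.

(** * Setting x = 0, and antiderivatives of powers of x *)

Section Evaluation.
Variable K : fieldType.
Local Notation P := {mpoly K[3]}.

(** Besides giving the case x = 0, this map encodes independence of x: its values do not involve
    x. *)
Definition set_x0 : P -> P :=
  comp_mpoly [tuple if i == ix then 0 else 'X_i | i < 3].

HB.instance Definition _ := GRing.RMorphism.copy set_x0
  (comp_mpoly [tuple if i == ix then 0 else 'X_i | i < 3]).

Lemma set_x0C c : set_x0 c%:MP = c%:MP.
Proof. exact: comp_mpolyC. Qed.

Lemma set_x0Z c p : set_x0 (c *: p) = c *: set_x0 p.
Proof. exact: comp_mpolyZ. Qed.

Lemma set_x0X i : set_x0 'X_i = if i == ix then 0 else 'X_i.
Proof. by rewrite /set_x0 comp_mpolyXU -tnth_nth tnth_mktuple. Qed.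

Lemma set_x0_monomial (u : 'X_{1..3}) :
  set_x0 'X_[u] = if u ix == 0%N then 'X_[u] else 0.
Proof.
rewrite /set_x0 comp_mpolyX; case: eqP => [ux0|/eqP ux].
  rewrite [RHS]mpolyXE_id; apply: eq_bigr => i _; rewrite tnth_mktuple.
  by case: eqP => // ->; rewrite ux0 !expr0.
by rewrite (bigD1 ix) //= tnth_mktuple eqxx expr0n (negPf ux) mul0r.
Qed.

Lemma iy_neq_ix : (iy == ix) = false.
Proof. by rewrite -val_eqE /= !inordK. Qed.

Lemma iz_neq_ix : (iz == ix) = false.
Proof. by rewrite -val_eqE /= !inordK. Qed.

(** By linearity it suffices to treat monomials; one that survives x = 0 has x-exponent 0, so after
    multiplication by x^k the exponent is exactly [k]. *)
Lemma mantideriv_expX_set_x0 k p :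
  mantideriv ix ('X_ix ^+ k * set_x0 p) = k.+1%:R^-1 *: ('X_ix ^+ k.+1 * set_x0 p).
Proof.
rewrite [p]mpolyE raddf_sum /= !mulr_sumr raddf_sum scaler_sumr.
apply: eq_bigr => u _; rewrite set_x0Z -!scalerAr [LHS]linearZ [RHS]scalerA.
rewrite (mulrC _^-1) -scalerA; congr (_ *: _) => /=; rewrite set_x0_monomial.
case: eqP => [ux0|_]; last by rewrite !mulr0 linear0 scaler0.
rewrite !mpolyXn -!mpolyXD mantiderivX mnmDE mulmnE mnm1E eqxx mul1n ux0 addn0.
by congr (_ *: 'X_[_]); rewrite mulmS [LHS]addmC addmA.
Qed.

End Evaluation.

(** * Coefficientwise partial derivatives of polynomials in t *)

Section Derivation.
Variables (d : nat) (R : comNzRingType) (i : 'I_d).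
Local Notation P := {mpoly R[d]}.

Lemma mderivXU (j : 'I_d) : mderiv i ('X_j : P) = (j == i)%:R.
Proof.
rewrite mderivX mnm1E; case: eqP => [->|_]; last by rewrite scale0r.
by rewrite scale1r -{1}[U_(i)%MM]add0m addmK mpolyX0.
Qed.

Lemma map_mderivM (p q : {poly P}) :
  map_poly (mderiv i) (p * q) = map_poly (mderiv i) p * q + p * map_poly (mderiv i) q.
Proof.
apply/polyP => n; rewrite coefD !coefM coef_map coefM raddf_sum -big_split.
by apply: eq_bigr => k _; rewrite /= mderivM !coef_map.
Qed.

End Derivation.

(** * The series exp(y t + z t^r) and its y-derivative *)

Section GouldHopper.
Variables (K : numFieldType) (r : nat).
Local Notation P := {mpoly K[3]}.

Definition gould_hopper_exponent : nat -> P :=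
  fps_add (fps_monomial 'X_iy 1) (fps_monomial 'X_iz r).

Definition gould_hopper_exp : nat -> P :=
  fps_comp (exp_series K) gould_hopper_exponent.

Local Notation F := ('X_iy *: 'X + 'X_iz *: 'X^r : {poly P}).

Lemma gould_hopper_exponent_coef n : gould_hopper_exponent n = F`_n.
Proof.
rewrite /gould_hopper_exponent /fps_add /fps_monomial coefD !coefZ coefX coefXn.
by congr (_ + _); case: eqP; rewrite ?mulr1 ?mulr0.
Qed.

Lemma gould_hopper_expE n :
  gould_hopper_exp n = \sum_(k < n.+1) k`!%:R^-1 *: (F ^+ k)`_n.
Proof.
by apply: eq_bigr => k _; rewrite (fps_exp_coef _ _ gould_hopper_exponent_coef).
Qed.

Lemma set_x0_gould_hopper_exp n : set_x0 (gould_hopper_exp n) = gould_hopper_exp n.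
Proof.
have F0 : map_poly (@set_x0 K) F = F.
  rewrite rmorphD /= !map_polyZ map_polyX map_polyXn /= !set_x0X.
  by rewrite iy_neq_ix iz_neq_ix.
rewrite gould_hopper_expE raddf_sum; apply: eq_bigr => k _ /=.
by rewrite set_x0Z -coef_map rmorphXn /= F0.
Qed.

(** The power rule, by induction with the Leibniz rule, starting from dF/dy = t. *)
Lemma mderiv_gould_hopper_power k :
  map_poly (mderiv iy) (F ^+ k.+1) = 'X * F ^+ k *+ k.+1.
Proof.
have dF : map_poly (mderiv iy) F = 'X.
  apply/polyP => n; rewrite coef_map coefD !coefZ coefX coefXn !mulr_natr /=.
  rewrite raddfD !raddfMn /= !mderivXU eqxx.
  by rewrite -val_eqE /= !inordK //= mul0rn addr0.
elim: k => [|k IHk]; first by rewrite expr1 expr0 mulr1 dF.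
by rewrite exprS map_mderivM dF IHk mulrnAr mulrCA -exprS -mulrS.
Qed.

Lemma mderiv_gould_hopper_exp n :
  mderiv iy (gould_hopper_exp n) = if n is n'.+1 then gould_hopper_exp n' else 0.
Proof.
(* The term [k = 0] is constant in y and disappears; the others are reindexed by [k.+1]. *)
rewrite gould_hopper_expE big_ord_recl raddfD raddf_sum /= linearZ /= expr0 coef1.
rewrite raddfMn /= -mpolyC1 mderivC mul0rn scaler0 add0r.
case: n => [|n]; first by rewrite big_ord0.
rewrite gould_hopper_expE; apply: eq_bigr => k _; rewrite /bump /= add1n.
rewrite linearZ /= -coef_map mderiv_gould_hopper_power coefMn coefXM /=.
rewrite -scaler_nat scalerA; congr (_ *: _).
by rewrite factS natrM invfM mulrAC mulVf ?mul1r // pnatr_eq0.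
Qed.

End GouldHopper.

(** * The Appell coefficients H and the two sides of the identity *)

Section Appell.
Variables (K : numFieldType) (r : nat) (g : nat -> K).
Local Notation P := {mpoly K[3]}.

Definition gould_hopper_appell : nat -> P :=
  fps_mul (appell_series g) (@gould_hopper_exp K r).
Local Notation H := gould_hopper_appell.

Lemma set_x0_gould_hopper_appell n : set_x0 (H n) = H n.
Proof.
rewrite raddf_sum; apply: eq_bigr => i _ /=.
by rewrite rmorphM /= set_x0C set_x0_gould_hopper_exp.
Qed.

Lemma mderiv_gould_hopper_appell n :
  mderiv iy (H n) = if n is n'.+1 then H n' else 0.
Proof.
rewrite raddf_sum /=.
under eq_bigr do rewrite mderiv_mulC mderiv_gould_hopper_exp.
(* The last term holds the derivative of the constant coefficient of the exponential, which is 0. *)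
rewrite big_ord_recr /= subnn mulr0 addr0.
case: n => [|n]; first by rewrite big_ord0.
by apply: eq_bigr => i _; rewrite /= subSn // -ltnS.
Qed.

Lemma iter_mderiv_gould_hopper_appell n j :
  iter j (mderiv iy) (H n) = if (j <= n)%N then H (n - j)%N else 0.
Proof.
elim: j => [|j IHj]; first by rewrite subn0.
rewrite iterS IHj; case: ltngtP => [lt_jn|lt_nj|->].
- by rewrite mderiv_gould_hopper_appell -subnSK.
- by rewrite mderiv0.
- by rewrite subnn mderiv_gould_hopper_appell.
Qed.

(** Writing the shifted coefficients as y-derivatives of [H n] absorbs the condition [m * k <= n]
    and matches the iterates of the operator. *)
Lemma LGHA_seriesE m n : (0 < m)%N ->
  LGHA_series m r g n =
  \sum_(k < n.+1) (k`!%:R ^+ 2)^-1 *: ('X_ix ^+ k * iter (m * k) (mderiv iy) (H n)).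
Proof.
move=> m_gt0; rewrite /LGHA_series fps_mulCA fps_mul_comp_monomial //.
apply: eq_bigr => k _; rewrite iter_mderiv_gould_hopper_appell /bessel_tricomi0.
(* The sign in C_0 cancels the one in (-x)^k; both depend only on the parity of [k]. *)
rewrite (exprNn 'X_ix) -mulrA -(signr_odd P) -(signr_odd K).
by case: (odd k); rewrite ?expr0 ?expr1 ?mulN1r ?mul1r ?scalerN // scaleNr opprK.
Qed.

(** At x = 0 only the term [k = 0] of the expansion survives. *)
Lemma GHA_E m n : (0 < m)%N -> GHA m r g n = n`!%:R *: H n.
Proof.
move=> m_gt0; rewrite /GHA /LGHA -/(set_x0 _) set_x0Z LGHA_seriesE //.
congr (_ *: _); rewrite raddf_sum big_ord_recl /= big1 => [|k _].
  rewrite muln0 expr1n invr1 scale1r mul1r addr0.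
  exact: set_x0_gould_hopper_appell.
by rewrite set_x0Z rmorphM rmorphXn /= set_x0X eqxx expr0n mul0r scaler0.
Qed.

(** Since d/dy commutes with multiplication by x^k, the two operators act separately, and k
    antiderivations of 1 give x^k / k!. The scalar [c] makes room for the factor n! of [GHA]. *)
Lemma iter_Dxinv_Dym m n k c :
  iter k (@Dxinv_Dym K m) (c *: H n) =
  (c / k`!%:R) *: ('X_ix ^+ k * iter (m * k) (mderiv iy) (H n)).
Proof.
elim: k => [|k IHk]; first by rewrite muln0 divr1 mul1r.
rewrite iterS IHk /Dxinv_Dym.
have iterZX q j : iter j (mderiv iy) ((c / k`!%:R) *: ('X_ix ^+ k * q)) =
    (c / k`!%:R) *: ('X_ix ^+ k * iter j (mderiv iy) q).
  elim: j => //= j ->; rewrite mderivZ mderivM.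
  have -> : mderiv iy ('X_ix ^+ k : P) = 0; last by rewrite mul0r add0r.
  rewrite mpolyXn mderivX mulmnE mnm1E [ix == _]eq_sym iy_neq_ix mul0n.
  exact: scale0r.
rewrite iterZX -iterD -mulnS iter_mderiv_gould_hopper_appell linearZ /=.
(* Exhibits the cofactor of x^k as free of x. *)
have -> : (if (m * k.+1 <= n)%N then H (n - m * k.+1)%N else 0) =
    set_x0 (if (m * k.+1 <= n)%N then H (n - m * k.+1)%N else 0).
  by case: ifP; rewrite ?raddf0 ?set_x0_gould_hopper_appell.
rewrite mantideriv_expX_set_x0 scalerA factS natrM invfM.
by rewrite -mulrA [_^-1 * _^-1 in LHS]mulrC.
Qed.

End Appell.

Unset Implicit Arguments.

Theorem theorem2p6 (K : numFieldType) (m r : nat) (hm : (1 <= m)%N)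
    (hr : (1 <= r)%N) (g : nat -> K) (hg0 : g 0%N != 0) (n : nat) :
  LGHA m r g n = exp_op (@Dxinv_Dym K m) (GHA m r g n).
Proof.
rewrite GHA_E // (@exp_op_finite _ _ _ _ n.+1) => [|k lt_nk].
  rewrite /LGHA LGHA_seriesE // scaler_sumr; apply: eq_bigr => k _.
  rewrite iter_Dxinv_Dym !scalerA; congr (_ *: _).
  (* One k! comes from the exponential, the other from the iterated antiderivative. *)
  by rewrite expr2 invfM mulrCA.
(* For [k > n], [m >= 1] gives [m * k > n], so the derivative of order [m * k] kills [H n]. *)
rewrite iter_Dxinv_Dym iter_mderiv_gould_hopper_appell leqNgt.
by rewrite (leq_trans lt_nk) ?leq_pmull // mulr0 scaler0.
Qed.
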